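(* Let $(\mathfrak{g},[-,-]_{\mathfrak{g}},P)$ be a Rota-Baxter Lie algebra of weight $\lambda$ and $(V,\rho)$ be a representation of the Lie algebra $(\mathfrak{g},[-,-]_{\mathfrak{g}})$. Let $\beta:V\rightarrow V$ be a linear map which is admissible to $(\mathfrak{g},[-,-]_{\mathfrak{g}},P)$ on $(V,\rho)$. Let $Q:\mathfrak{g}\rightarrow\mathfrak{g}$, $\alpha:V\rightarrow V$ and $T:V\rightarrow \mathfrak{g}$ be linear maps. (a) $r=T-\tau(T)$ is an antisymmetric solution of the $(Q+\alpha^{*})$-admissible classical Yang-Baxter equation in the Rota-Baxter Lie algebra $(\mathfrak{g}\ltimes_{\rho^{*}}V^{*},P+\beta^{*})$ if and only if $T$ is a weak $\mathcal{O}$-operator associated to $(V,\rho)$ and $\alpha$, and satisfies $T\beta=QT$. (b) Assume that $(V,\rho,\alpha)$ is a representation of $(\mathfrak{g},[-,-]_{\mathfrak{g}},P)$. If $T$ is an $\mathcal{O}$-operator associated to $(V,\rho,\alpha)$ and $T\beta=QT$, then $r=T-\tau(T)$ is an antisymmetric solution of the $(Q+\alpha^{*})$-admissible classical Yang-Baxter equation in the Rota-Baxter Lie algebra $(\mathfrak{g}\ltimes_{\rho^{*}}V^{*},P+\beta^{*})$. If in addition $(\mathfrak{g},[-,-]_{\mathfrak{g}},P)$ is $Q$-admissible and $$\beta(\rho(x)\alpha(v))=\beta(\rho(Q(x))v)+\rho(Q(x))\alpha(v)+\lambda\rho(Q(x))v,\quad\forall x\in\mathfrak{g},v\in V$$ (so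 that the Rota-Baxter Lie algebra $(\mathfrak{g}\ltimes_{\rho^{*}}V^{*},P+\beta^{*})$ is $(Q+\alpha^{*})$-admissible), then there is a Rota-Baxter Lie bialgebra $(\mathfrak{g}\ltimes_{\rho^{*}}V^{*},P+\beta^{*},\delta,Q+\alpha^{*})$ of weight $\lambda$, where $\delta=\delta_{r}$ is defined by $\delta_r(u)=(\mathrm{ad}(u)\otimes\mathrm{id}+\mathrm{id}\otimes\mathrm{ad}(u))r$ for $u\in\mathfrak{g}\ltimes_{\rho^{*}}V^{*}$, with $r=T-\tau(T)$.
   Context: All vector spaces and algebras are finite-dimensional over a field $\mathbb K$ of characteristic zero; $\lambda\in\mathbb K$; $\tau$ is the flip; $\mathrm{ad}(x)y=[x,y]$. A Rota-Baxter Lie algebra of weight $\lambda$ is $(\mathfrak{g},[-,-],P)$ with $[P(x),P(y)]=P([x,P(y)])+P([P(x),y])+\lambda P([x,y])$. It is $Q$-admissible, for $Q:\mathfrak g\to\mathfrak g$ linear, if $Q([P(x),y])-[P(x),Q(y)]-Q([x,Q(y)])-\lambda[x,Q(y)]=0$ for all $x,y$. A representation of it is $(V,\rho,\alpha)$ with $(V,\rho)$ a Lie algebra representation and $\alpha:V\to V$ linear with $\rho(P(x))\alpha(v)=\alpha(\rho(P(x))v)+\alpha(\rho(x)\alpha(v))+\lambda\alpha(\rho(x)v)$. A linear map $\beta:V\to V$ is admissible to $(\mathfrak g,[-,-],P)$ on $(V,\rho)$ if $\beta(\rho(P(x))v)-\rho(P(x))\beta(v)-\beta(\rho(x)\beta(v))-\lambda\rho(x)\beta(v)=0$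 for all $x,v$. $T^*$ denotes transposes of linear maps; $\rho^*:\mathfrak g\to\mathrm{End}(V^* )$ is given by $\langle\rho^*(x)v^*,u\rangle=-\langle v^*,\rho(x)u\rangle$. $\mathfrak g\ltimes_{\rho^*}V^*$ is $\mathfrak g\oplus V^*$ with bracket $[x+u^*,y+v^*]=[x,y]+\rho^*(x)v^*-\rho^*(y)u^*$. For linear $\phi_i:V_i\to V_i$, $\phi_1+\phi_2$ denotes $v_1+v_2\mapsto\phi_1(v_1)+\phi_2(v_2)$ on $V_1\oplus V_2$. When $\beta$ is admissible to $(\mathfrak g,P)$ on $(V,\rho)$, $(\mathfrak g\ltimes_{\rho^*}V^*,P+\beta^* )$ is a Rota-Baxter Lie algebra of weight $\lambda$. A linear map $T:V\to\mathfrak g$ is regarded as an element of $(\mathfrak g\ltimes_{\rho^*}V^* )^{\otimes2}$ via $\mathrm{Hom}(V,\mathfrak g)\cong\mathfrak g\otimes V^*$, i.e. $T=\sum_iT(v_i)\otimes v_i^*$ for a basis $\{v_i\}$ of $V$ with dual basis $\{v_i^*\}$. Weak $\mathcal O$-operator: $T:V\to\mathfrak g$ is a weak $\mathcal{O}$-operator associated to $(V,\rho)$ and $\alpha$ if $[T(u),T(v)]=T(\rho(T(u))v-\rho(T(v))u)$ for all $u,v\in V$ and $PT=T\alpha$. If in addition $(V,\rho,\alpha)$ is a representation of $(\mathfrak g,[-,-],P)$, $T$ is called an $\mathcal{O}$-operator associated to $(V,\rho,\alpha)$. For a Rota-Baxter Lie algebra $(\mathfrak h,R)$ and linear $S:\mathfrak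 h\to\mathfrak h$, $r=\sum_ia_i\otimes b_i\in\mathfrak h\otimes\mathfrak h$ is a solution of the $S$-admissible classical Yang-Baxter equation in $(\mathfrak h,R)$ if $\sum_{i,j}\big([a_{i},a_{j}]\otimes b_{i}\otimes b_{j}+a_{i}\otimes[b_{i},a_{j}]\otimes b_{j}+a_{i}\otimes a_{j}\otimes[b_{i},b_{j}]\big)=0$, $(R\otimes\mathrm{id}-\mathrm{id}\otimes S)(r)=0$ and $(S\otimes\mathrm{id}-\mathrm{id}\otimes R)(r)=0$. It is antisymmetric if $r=-\tau(r)$. A Rota-Baxter Lie bialgebra $(\mathfrak h,R,\delta,S)$ of weight $\lambda$: $(\mathfrak h,[-,-],\delta)$ is a Lie bialgebra, $(\mathfrak h,[-,-],R)$ is an $S$-admissible Rota-Baxter Lie algebra of weight $\lambda$, and for all $x\in\mathfrak h$: $(S\otimes S)\delta(x)=(S\otimes\mathrm{id}+\mathrm{id}\otimes S)\delta(S(x))+\lambda\delta(S(x))$ and $(R\otimes S)\delta(x)+(R\otimes\mathrm{id}-\mathrm{id}\otimes S)\delta(R(x))+\lambda(R\otimes\mathrm{id})\delta(x)=0$. *)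

(* Defs.v *)
From HB Require Import structures.
From mathcomp Require Import all_boot all_order all_algebra ring.

Set Implicit Arguments.
Unset Strict Implicit.
Unset Printing Implicit Defensive.

Import GRing.Theory.
Local Open Scope ring_scope.

Reserved Notation "u ⊗ w" (at level 38, right associativity).

(* Tensor product of finite-dimensional spaces, in coordinates over the bases
   [vbasis]. [tlift] is the linear map out of [tens U W] induced by a bilinear
   map; [tlift_tens], [tlift_is_linear] and [tens_decomp] give the universal
   property, so that nothing below depends on the choice of bases. *)

Definition tens (K : fieldType) (U W : vectType K) : vectType K :=
  'M[K]_(\dim {:U}, \dim {:W}).

Definition pure (K : fieldType) (U W : vectType K) (u : U) (w : W) : tens U W :=
  \matrix_(i, j) (coord (vbasis {:U}) i u * coord (vbasis {:W}) j w).

Notation "u ⊗ w" := (pure u w) : ring_scope.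

Definition tlift (K : fieldType) (U W : vectType K) (X : lmodType K)
    (B : U -> W -> X) (t : tens U W) : X :=
  \sum_i \sum_j t i j *: B (vbasis {:U})`_i (vbasis {:W})`_j.

Definition tmap (K : fieldType) (U U' W W' : vectType K)
    (f : U -> U') (g : W -> W') : tens U W -> tens U' W' :=
  tlift (fun u w => f u ⊗ g w).

Definition flip (K : fieldType) (U W : vectType K) : tens U W -> tens W U :=
  tlift (fun u w => w ⊗ u).

(* a ⊗ b ⊗ c |-> b ⊗ c ⊗ a *)
Definition cyc3 (K : fieldType) (U : vectType K)
    (t : tens U (tens U U)) : tens U (tens U U) :=
  tlift (fun a => tlift (fun b c => b ⊗ c ⊗ a)) t.

Definition dual (K : fieldType) (V : vectType K) : vectType K := 'Hom(V, K^o).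

Definition transpose (K : fieldType) (U W : vectType K) (f : 'Hom(U, W))
    (phi : dual W) : dual U := (phi \o f)%VF.

Definition dsum (K : fieldType) (U W : vectType K) (f : U -> U) (g : W -> W)
    (z : U * W) : U * W := (f z.1, g z.2).

Definition bilin (K : fieldType) (U W X : lmodType K) (B : U -> W -> X) : Prop :=
  (forall u, linear (B u)) /\ (forall w, linear (B^~ w)).

Definition is_lie (K : fieldType) (g : vectType K) (br : g -> g -> g) : Prop :=
  [/\ bilin br,
      forall x, br x x = 0
    & forall x y z, br x (br y z) + br y (br z x) + br z (br x y) = 0].

Definition is_lie_rep (K : fieldType) (g V : vectType K) (br : g -> g -> g)
    (rho : g -> 'End(V)) : Prop :=
  linear rho /\
  forall x y v, rho (br x y) v = rho x (rho y v) - rho y (rho x v).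

Definition is_rb_lie (K : fieldType) (lambda : K) (g : vectType K)
    (br : g -> g -> g) (P : g -> g) : Prop :=
  [/\ is_lie br,
      linear P
    & forall x y, br (P x) (P y) =
        P (br x (P y)) + P (br (P x) y) + lambda *: P (br x y)].

Definition is_admissible_rb_lie (K : fieldType) (lambda : K) (g : vectType K)
    (br : g -> g -> g) (P Q : g -> g) : Prop :=
  [/\ is_rb_lie lambda br P,
      linear Q
    & forall x y, Q (br (P x) y) - br (P x) (Q y) - Q (br x (Q y))
        - lambda *: br x (Q y) = 0].

Definition is_rb_rep (K : fieldType) (lambda : K) (g V : vectType K)
    (br : g -> g -> g) (P : g -> g) (rho : g -> 'End(V)) (alpha : V -> V) : Prop :=
  [/\ is_lie_rep br rho,
      linear alpha
    & forall x v, rho (P x) (alpha v) =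
        alpha (rho (P x) v) + alpha (rho x (alpha v))
        + lambda *: alpha (rho x v)].

Definition admissible_on (K : fieldType) (lambda : K) (g V : vectType K)
    (P : g -> g) (rho : g -> 'End(V)) (beta : V -> V) : Prop :=
  forall x v, beta (rho (P x) v) - rho (P x) (beta v) - beta (rho x (beta v))
    - lambda *: rho x (beta v) = 0.

Definition dual_rep (K : fieldType) (g V : vectType K) (rho : g -> 'End(V))
    (x : g) (phi : dual V) : dual V := - transpose (rho x) phi.

Definition semidirect (K : fieldType) (g V : vectType K) (br : g -> g -> g)
    (rho : g -> 'End(V)) (z1 z2 : g * dual V) : g * dual V :=
  (br z1.1 z2.1, dual_rep rho z1.1 z2.2 - dual_rep rho z2.1 z1.2).

(* T as an element of the tensor square of the semidirect product, through
   Hom(V, g) = g ⊗ dual V; independent of the basis by [tensor_of_basis]. *)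
Definition tensor_of (K : fieldType) (g V : vectType K) (T : 'Hom(V, g)) :
    tens (g * dual V)%type (g * dual V)%type :=
  \sum_(i < \dim {:V}) (T (vbasis {:V})`_i, 0)
         ⊗ (0, linfun (coord (vbasis {:V}) i : V -> K^o)).

Definition weak_O_operator (K : fieldType) (g V : vectType K)
    (br : g -> g -> g) (P : g -> g) (rho : g -> 'End(V)) (alpha : V -> V)
    (T : V -> g) : Prop :=
  (forall u v, br (T u) (T v) = T (rho (T u) v - rho (T v) u)) /\
  (forall v, P (T v) = T (alpha v)).

Definition O_operator (K : fieldType) (lambda : K) (g V : vectType K)
    (br : g -> g -> g) (P : g -> g) (rho : g -> 'End(V)) (alpha : V -> V)
    (T : V -> g) : Prop :=
  is_rb_rep lambda br P rho alpha /\ weak_O_operator br P rho alpha T.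

(* The left-hand side of the classical Yang-Baxter equation: for
   r = \sum_i a_i ⊗ b_i, (a, b) runs over the (a_i, b_i) and (a', b') over the
   (a_j, b_j); see [yb_sum]. *)
Definition yb (K : fieldType) (h : vectType K) (br : h -> h -> h)
    (r : tens h h) : tens h (tens h h) :=
  tlift (fun a b => tlift (fun a' b' =>
    br a a' ⊗ b ⊗ b' + a ⊗ br b a' ⊗ b' + a ⊗ a' ⊗ br b b') r) r.

Definition admissible_cybe (K : fieldType) (h : vectType K)
    (br : h -> h -> h) (R S : h -> h) (r : tens h h) : Prop :=
  [/\ yb br r = 0,
      tmap R idfun r - tmap idfun S r = 0
    & tmap S idfun r - tmap idfun R r = 0].

Definition antisymmetric_tensor (K : fieldType) (h : vectType K)
    (r : tens h h) : Prop := r = - flip r.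

Definition ad2 (K : fieldType) (h : vectType K) (br : h -> h -> h) (x : h)
    (t : tens h h) : tens h h :=
  tmap (br x) idfun t + tmap idfun (br x) t.

Definition is_lie_coalgebra (K : fieldType) (h : vectType K)
    (delta : h -> tens h h) : Prop :=
  [/\ linear delta,
      forall x, antisymmetric_tensor (delta x)
    & forall x, let t := tmap idfun delta (delta x) in
        t + cyc3 t + cyc3 (cyc3 t) = 0].

Definition is_lie_bialgebra (K : fieldType) (h : vectType K)
    (br : h -> h -> h) (delta : h -> tens h h) : Prop :=
  [/\ is_lie br,
      is_lie_coalgebra delta
    & forall x y, delta (br x y) = ad2 br x (delta y) - ad2 br y (delta x)].

Definition is_rb_lie_bialgebra (K : fieldType) (lambda : K) (h : vectType K)
    (br : h -> h -> h) (R : h -> h) (delta : h -> tens h h) (S : h -> h) : Prop :=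
  [/\ is_lie_bialgebra br delta,
      is_admissible_rb_lie lambda br R S,
      forall x, tmap S S (delta x) =
        tmap S idfun (delta (S x)) + tmap idfun S (delta (S x))
        + lambda *: delta (S x)
    & forall x, tmap R S (delta x)
        + (tmap R idfun (delta (R x)) - tmap idfun S (delta (R x)))
        + lambda *: tmap R idfun (delta x) = 0].

Lemma tens_bilin (K : fieldType) (U W : vectType K) : bilin (@pure K U W).
Proof.
split=> [u|w] c x y; apply/matrixP=> i j; rewrite !mxE linearP /=.
  by rewrite mulrDr mulrCA.
by rewrite mulrDl mulrA.
Qed.

Lemma tens_decomp (K : fieldType) (U W : vectType K) (t : tens U W) :
  t = \sum_i \sum_j t i j *: ((vbasis {:U})`_i ⊗ (vbasis {:W})`_j).
Proof.
apply/matrixP=> k l; rewrite summxE (bigD1 k) //= summxE (bigD1 l) //= !mxE.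
rewrite !coord_free ?(basis_free (vbasisP _)) // !eqxx !mulr1.
rewrite big1 ?addr0 => [|j /negbTE jl]; last first.
  by rewrite !mxE !coord_free ?(basis_free (vbasisP _)) // [_ == l]jl !mulr0.
rewrite big1 ?addr0 // => i /negbTE ik; rewrite summxE big1 // => j _.
by rewrite !mxE !coord_free ?(basis_free (vbasisP _)) // [_ == k]ik mul0r mulr0.
Qed.

Lemma tlift_is_linear (K : fieldType) (U W : vectType K) (X : lmodType K)
  (B : U -> W -> X) : linear (tlift B).
Proof.
move=> c s t; rewrite /tlift scaler_sumr -big_split; apply: eq_bigr => i _ /=.
rewrite scaler_sumr -big_split; apply: eq_bigr => j _ /=.
by rewrite !mxE scalerDl scalerA.
Qed.

Lemma linear_comb (K : fieldType) (U X : lmodType K) (f : U -> X)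
    (I : Type) (s : seq I) (c : I -> K) (F : I -> U) : linear f ->
  f (\sum_(i <- s) c i *: F i) = \sum_(i <- s) c i *: f (F i).
Proof.
move=> fl; pose fi := GRing.isLinear.Build _ _ _ _ f fl.
pose fL : {linear U -> X} := HB.pack f fi.
rewrite -[f]/(fL : U -> X) (linear_sum fL); by apply: eq_bigr => i _; rewrite linearZ.
Qed.

Lemma tlift_tens (K : fieldType) (U W : vectType K) (X : lmodType K)
  (B : U -> W -> X) (u : U) (w : W) : bilin B -> tlift B (u ⊗ w) = B u w.
Proof.
case=> Br Bl; rewrite {2}(coord_vbasis (memvf u)) (linear_comb _ _ _ (Bl w)).
apply: eq_bigr => i _; rewrite {2}(coord_vbasis (memvf w)).
rewrite (linear_comb _ _ _ (Br _)) scaler_sumr.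
by apply: eq_bigr => j _; rewrite mxE scalerA.
Qed.

HB.instance Definition _ (K : fieldType) (U W : vectType K) (X : lmodType K)
  (B : U -> W -> X) :=
  GRing.isLinear.Build K (tens U W) X _ (tlift B) (tlift_is_linear B).

Lemma tlift_comb (K : fieldType) (U W : vectType K) (X : lmodType K)
    (c : K) (B B1 B2 : U -> W -> X) (t : tens U W) :
    (forall u w, B u w = c *: B1 u w + B2 u w) ->
  tlift B t = c *: tlift B1 t + tlift B2 t.
Proof.
move=> BE; rewrite /tlift scaler_sumr -big_split; apply: eq_bigr => i _ /=.
rewrite scaler_sumr -big_split; apply: eq_bigr => j _ /=.
by rewrite BE scalerDr !scalerA mulrC.
Qed.

Lemma yb_sum (K : fieldType) (h : vectType K) (br : h -> h -> h) (n : nat)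
    (a b : 'I_n -> h) : bilin br ->
  yb br (\sum_i a i ⊗ b i) =
  \sum_i \sum_j (br (a i) (a j) ⊗ b i ⊗ b j + a i ⊗ br (b i) (a j) ⊗ b j
                 + a i ⊗ a j ⊗ br (b i) (b j)).
Proof.
case=> brr brl.
have pr U W := (@tens_bilin K U W).1.
have pl U W := (@tens_bilin K U W).2.
have AC (X : lmodType K) c (p q r p' q' r' : X) :
    c *: p + p' + (c *: q + q') + (c *: r + r')
    = c *: (p + q + r) + (p' + q' + r').
  by rewrite !scalerDr (addrACA (c *: p)) (addrACA (c *: p + c *: q)).
have brrE x c u v : br x (c *: u + v) = c *: br x u + br x v by exact: brr.
have brlE x c u v : br (c *: u + v) x = c *: br u x + br v x by exact: (brl x).
have prE (U W : vectType K) (x : U) c (u v : W) :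
  x ⊗ (c *: u + v) = c *: (x ⊗ u) + x ⊗ v by exact: pr.
have plE (U W : vectType K) (x : W) c (u v : U) :
  (c *: u + v) ⊗ x = c *: (u ⊗ x) + v ⊗ x by exact: (pl U W x).
rewrite /yb linear_sum; apply: eq_bigr => i _ /=.
rewrite tlift_tens.
  rewrite linear_sum; apply: eq_bigr => j _ /=.
  by rewrite tlift_tens //; split=> [u|w] c x y /=;
     rewrite ?(brrE, brlE, prE, plE) AC.
split=> [u|w] c x y /=; apply: tlift_comb => a' b';
by rewrite ?(brrE, brlE, prE, plE) AC.
Qed.

Lemma tensor_of_basis (K : fieldType) (g V : vectType K) (T : 'Hom(V, g))
    (e : (\dim {:V}).-tuple V) : basis_of {:V} e ->
  tensor_of T = \sum_(i < \dim {:V}) (T e`_i, 0)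
                  ⊗ (0, linfun (coord e i : V -> K^o)).
Proof.
move=> eb; pose b := vbasis {:V}.
have pr U W := (@tens_bilin K U W).1.
have pl U W := (@tens_bilin K U W).2.
have TE i : (T b`_i, 0 : dual V) = \sum_j coord e j b`_i *: (T e`_j, 0).
  rewrite {1}(coord_basis eb (memvf b`_i)) linear_sum /=.
  have fl : linear (fun x : g => (x, 0 : dual V)).
    by move=> c x y; apply: (congr2 pair); rewrite /= ?scaler0 ?addr0.
  rewrite -(linear_comb _ _ _ fl); congr (_, _).
  by apply: eq_bigr => j _; rewrite linearZ.
have cE j : (0 : g, linfun (coord e j : V -> K^o))
    = \sum_(i < \dim {:V}) coord e j b`_i *: (0, linfun (coord b i : V -> K^o)).
  have fl : linear (fun x : dual V => (0 : g, x)).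
    by move=> c x y; apply: (congr2 pair); rewrite /= ?scaler0 ?addr0.
  rewrite -(linear_comb _ _ _ fl); congr (_, _); apply/lfunP => v.
  rewrite sum_lfunE lfunE /= {1}(coord_vbasis (memvf v)) linear_sum /=.
  by apply: eq_bigr => i _; rewrite linearZ scale_lfunE lfunE /= mulrC.
rewrite /tensor_of -/b.
under eq_bigr => i _ do rewrite TE (linear_comb _ _ _ (pl _ _ _)).
rewrite exchange_big; apply: eq_bigr => j _ /=.
by rewrite cE (linear_comb _ _ _ (pr _ _ _)).
Qed.

Lemma dual_repE (K : fieldType) (g V : vectType K) (rho : g -> 'End(V))
  (x : g) (phi : dual V) (v : V) : dual_rep rho x phi v = - phi (rho x v).
Proof. by rewrite /dual_rep opp_lfunE comp_lfunE. Qed.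

Lemma transposeE (K : fieldType) (U W : vectType K) (f : 'Hom(U, W))
  (phi : dual W) (u : U) : transpose f phi u = phi (f u).
Proof. by rewrite comp_lfunE. Qed.

Lemma semidirect_rb_lie (K : fieldType) (lambda : K) (g V : vectType K)
    (br : g -> g -> g) (P : 'End(g)) (rho : g -> 'End(V)) (beta : 'End(V)) :
    is_rb_lie lambda br P -> is_lie_rep br rho ->
    admissible_on lambda P rho beta ->
  is_rb_lie lambda (semidirect br rho) (dsum P (transpose beta)).
Proof.
move=> [[[brr brl] alt jac] _ rb] [rl rbr] adm.
have rE c x y v : rho (c *: x + y) v = c *: rho x v + rho y v.
  by rewrite rl add_lfunE scale_lfunE.
pose E := (add_lfunE, opp_lfunE, scale_lfunE, dual_repE, transposeE).
have pD (p : dual V) u v : p (u + v) = (p u + p v : K) by exact: linearD.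
have pB (p : dual V) u v : p (u - v) = (p u - p v : K) by exact: linearB.
have pZ (p : dual V) c v : p (c *: v) = (c * p v : K) by exact: linearZ.
have sE (a : K) (b : K^o) : a *: b = (a : K) * (b : K) :> K by [].
split; first split; first split.
- move=> [x p] c [y q] [z s]; congr (_, _); first exact: brr.
  apply/lfunP => v; rewrite /= !E /= !rE !pD !pZ !sE /=.
  rewrite -[LHS]/(_ : K) -[RHS]/(_ : K); ring.
- move=> [x p] c [y q] [z s]; congr (_, _); first exact: (brl x).
  apply/lfunP => v; rewrite /= !E /= !rE !pD !pZ !sE /=.
  ring.
- by move=> [x p]; congr (_, _); rewrite ?alt ?subrr.
- move=> [x p] [y q] [z s]; congr (_, _); first exact: jac.
  rewrite /semidirect /=; apply/lfunP => v; rewrite zero_lfunE !E !rbr !pB; ring.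
- move=> c [x p] [y q]; congr (_, _); first exact: linearP.
  by apply/lfunP => v; rewrite /= !E.
- move=> [x p] [y q]; congr (_, _); first exact: rb.
  have A z w : beta (rho (P z) w) =
      rho (P z) (beta w) + beta (rho z (beta w)) + lambda *: rho z (beta w).
    by have /eqP := adm z w; rewrite -!addrA -!opprD subr_eq0 !addrA => /eqP.
  rewrite /semidirect /dsum /=; apply/lfunP => v.
  rewrite !E !A !pD !pZ sE; ring.
Qed.

(* Main.v *)
(* A tensor r in h ⊗ h is studied through its contraction operator
   F : dual h -> h, p |-> (p ⊗ id) r, and every tensor identity is tested on
   functionals. For antisymmetric r the Yang-Baxter equation reads
     p [F q, F s] - q [F p, F s] + s [F p, F q] = 0   for all p, q, s,
   the two intertwining conditions read F (p \o R) = S (F p) and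
   F (p \o S) = R (F p), and delta_r (x) becomes the form
   (p, q) |-> q [x, F p] - p [x, F q]; the bialgebra axioms are then direct
   computations. For r = T - flip T, a functional p on g * dual V amounts to a
   pair (f, v) in dual g * V and F p = (- T v, f \o T), so that the Yang-Baxter
   equation separates into the O-operator identity on the three pairs of vectors
   of V. *)
From HB Require Import structures.
Require Import Defs.
From mathcomp Require Import all_boot all_order all_algebra ring.
Set Implicit Arguments.
Unset Strict Implicit.
Unset Printing Implicit Defensive.
Import GRing.Theory.
Local Open Scope ring_scope.

(** * Contraction of tensors with functionals, and separation by functionals *)

Section Contraction.
Variable K : fieldType.
Implicit Types U W X : vectType K.

(** Maps such as [br x] are bare functions with a proof of linearity; rewriting backwards with this
    equation makes the lemmas on bundled linear maps available for them. *)
Lemma linfunE U W (f : U -> W) : linear f -> linfun f =1 f.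
Proof.
move=> fl u; pose fi := GRing.isLinear.Build _ _ _ _ f fl.
pose fL : {linear U -> W} := HB.pack f fi.
by rewrite -[f]/(fL : U -> W) lfunE.
Qed.

Lemma dual_sep U (u : U) : (forall p : dual U, p u = 0) -> u = 0.
Proof.
move=> u0; rewrite (coord_vbasis (memvf u)) big1 // => i _.
by have := u0 (linfun (coord (vbasis {:U}) i : U -> K^o)); rewrite lfunE /= => ->;
   rewrite scale0r.
Qed.

Lemma dual_ext U (u v : U) : (forall p : dual U, p u = p v) -> u = v.
Proof.
by move=> uv; apply/subr0_eq/dual_sep => p; rewrite linearB /= uv subrr.
Qed.

(** Reflexivity in finite dimension: the coordinates of [u] are the values of [f] on the dual
    basis. *)
Lemma dual_dual_eval U (f : dual (dual U)) : exists u, forall p, f p = p u.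
Proof.
pose b := vbasis {:U}.
exists (\sum_(i < \dim {:U}) (f (linfun (coord b i : U -> K^o)) : K) *: b`_i) => p.
have pE : p = \sum_(i < \dim {:U}) (p b`_i : K) *: linfun (coord b i : U -> K^o).
  apply/lfunP => v; rewrite sum_lfunE {1}(coord_vbasis (memvf v)) linear_sum /=.
  by apply: eq_bigr => i _; rewrite linearZ scale_lfunE lfunE; apply: mulrC.
rewrite {1}pE !linear_sum; apply: eq_bigr => i _; rewrite !linearZ.
exact: mulrC.
Qed.

Definition contr U W (p : dual U) : tens U W -> W :=
  tlift (fun u w => (p u : K) *: w).

HB.instance Definition _ U W (p : dual U) :=
  GRing.isLinear.Build K (tens U W) W _ (@contr U W p) (tlift_is_linear _).

HB.instance Definition _ U W :=
  GRing.isLinear.Build K (tens U W) (tens W U) _ (@flip K U W) (tlift_is_linear _).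

HB.instance Definition _ U U' W W' (f : U -> U') (g : W -> W') :=
  GRing.isLinear.Build K (tens U W) (tens U' W') _ (tmap f g) (tlift_is_linear _).

HB.instance Definition _ U :=
  GRing.isLinear.Build K (tens U (tens U U)) (tens U (tens U U)) _ (@cyc3 K U)
    (tlift_is_linear _).

Lemma contr_pure U W (p : dual U) (u : U) (w : W) :
  contr p (u ⊗ w) = (p u : K) *: w.
Proof.
rewrite /contr tlift_tens //; split=> [a|b] c x y.
  by rewrite scalerDr !scalerA mulrC.
by rewrite linearP scalerDl scalerA.
Qed.

Lemma contr_sum U W (I : finType) (p : dual U) (F : I -> tens U W) :
  contr p (\sum_i F i) = \sum_i contr p (F i).
Proof. exact: linear_sum. Qed.

Lemma contrD U W (p : dual U) (t t' : tens U W) :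
  contr p (t + t') = contr p t + contr p t'.
Proof. exact: linearD. Qed.

Lemma contrN U W (p : dual U) (t : tens U W) : contr p (- t) = - contr p t.
Proof. exact: linearN. Qed.

Lemma contrZ U W (p : dual U) c (t : tens U W) : contr p (c *: t) = c *: contr p t.
Proof. exact: linearZ. Qed.

(** Collecting each row of the coordinate matrix into one second factor leaves a single sum of pure
    tensors, the shape that [yb_sum] expects. *)
Lemma tens_pure_sum U W (t : tens U W) :
  exists a : 'I_(\dim {:U}) -> U, exists b, t = \sum_i a i ⊗ b i.
Proof.
exists (fun i => (vbasis {:U})`_i).
exists (fun i => \sum_j t i j *: (vbasis {:W})`_j).
rewrite {1}[t]tens_decomp; apply: eq_bigr => i _.
by rewrite (linear_comb _ _ _ ((tens_bilin _ _).1 _)).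
Qed.

Lemma tens_ext U W (X : lmodType K) (f g : {linear tens U W -> X}) :
  (forall u w, f (u ⊗ w) = g (u ⊗ w)) -> f =1 g.
Proof.
move=> fg t; have [a [b ->]] := tens_pure_sum t.
by rewrite !linear_sum; apply: eq_bigr => i _.
Qed.

(** Contraction with the [i]-th coordinate functional returns the vector whose coordinates form row
    [i] of [t]. *)
Lemma contr_sep U W (t : tens U W) : (forall p, contr p t = 0) -> t = 0.
Proof.
move=> t0; apply/matrixP => i j; rewrite [RHS]mxE.
have := t0 (linfun (coord (vbasis {:U}) i : U -> K^o)).
have [a [b ->]] := tens_pure_sum t; rewrite linear_sum.
move/(congr1 (coord (vbasis {:W}) j)); rewrite linear0 linear_sum => <-.
by rewrite summxE; apply: eq_bigr => k _; rewrite /= contr_pure lfunE linearZ mxE.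
Qed.

Lemma contr_ext U W (t t' : tens U W) :
  (forall p, contr p t = contr p t') -> t = t'.
Proof.
by move=> tt'; apply/subr0_eq/contr_sep => p; rewrite linearB /= tt' subrr.
Qed.

Lemma tmap_pure U U' W W' (f : U -> U') (g : W -> W') u w :
  linear f -> linear g -> tmap f g (u ⊗ w) = f u ⊗ g w.
Proof.
move=> fl gl; rewrite /tmap tlift_tens //; split=> [a|b] c x y.
  by rewrite gl; apply: (tens_bilin _ _).1.
by rewrite fl; apply: ((tens_bilin _ _).2 _).
Qed.

Lemma contr_tmap U U' W W' (f : U -> U') (g : W -> W') p t :
    linear f -> linear g ->
  contr p (tmap f g t) = g (contr (transpose (linfun f) p) t).
Proof.
move=> fl gl; rewrite -(linfunE gl).
have := @tens_ext _ _ _ (contr p \o tmap f g)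
  (linfun g \o contr (transpose (linfun f) p)).
apply=> u w /=; rewrite tmap_pure // !contr_pure linearZ /=.
by rewrite transposeE !linfunE.
Qed.

Lemma contr_tmap_id U W W' (g : W -> W') p (t : tens U W) : linear g ->
  contr p (tmap idfun g t) = g (contr p t).
Proof.
move=> gl; rewrite contr_tmap //; congr (g (contr _ t)).
by apply/lfunP => u; rewrite transposeE linfunE.
Qed.

Lemma contr_flip U W (p : dual W) (q : dual U) (t : tens U W) :
  q (contr p (flip t)) = p (contr q t).
Proof.
have := @tens_ext _ _ _ (q \o contr p \o @flip K U W) (p \o contr q).
apply=> u w /=; rewrite /flip tlift_tens; last first.
  by split=> [a|b]; [apply: ((tens_bilin _ _).2 _) | apply: (tens_bilin _ _).1].
by rewrite !contr_pure !linearZ; apply: mulrC.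
Qed.

Lemma contr_cyc3 U (p q s : dual U) (t : tens U (tens U U)) :
  s (contr q (contr p (cyc3 t))) = q (contr p (contr s t)).
Proof.
have := @tens_ext _ _ _ (s \o contr q \o contr p \o @cyc3 K U)
  (q \o contr p \o contr s).
have pr (V W : vectType K) (x : V) c (u v : W) :
  x ⊗ (c *: u + v) = c *: (x ⊗ u) + x ⊗ v by exact: (tens_bilin _ _).1.
have pl (V W : vectType K) (x : W) c (u v : V) :
  (c *: u + v) ⊗ x = c *: (u ⊗ x) + v ⊗ x by exact: ((tens_bilin _ _).2 x).
apply=> a w /=; rewrite /cyc3 tlift_tens; last first.
  split=> [x|y] c x' y'; first exact: linearP.
  by apply: tlift_comb => b d; rewrite !pr.
(* The second factor [w] is itself a tensor, so a second reduction to pure tensors is made with [a]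
   fixed. *)
have := @tens_ext _ _ _
  (s \o contr q \o contr p \o tlift (fun b c : U => b ⊗ c ⊗ a))
  ((q \o contr p) \o ( *:%R (s a : K))).
rewrite contr_pure; apply=> b c /=; rewrite tlift_tens; last first.
  by split=> [x|y] d x' y'; rewrite ?(pl, pr).
rewrite linearZ /= !contr_pure !linearZ /= !contr_pure !linearZ /=.
(* Functionals take values in K^o; [ring] needs the operations of K. *)
rewrite -![_ *: _]/(_ * _ : K); ring.
Qed.

(** [q (contr p r)] is the bilinear form on functionals defined by [r], and [flip] exchanges its two
    arguments. *)
Lemma antisymmetric_contr U (r : tens U U) :
  antisymmetric_tensor r <-> forall p q : dual U, q (contr p r) = - p (contr q r).
Proof.
split=> [ra p q|ra].
  by rewrite -[in LHS]contr_flip {2}ra linearN /= linearN /= opprK.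
apply: contr_ext => p; apply: dual_ext => q.
by rewrite linearN /= linearN /= contr_flip.
Qed.

End Contraction.

(** * The classical Yang-Baxter equation in terms of the contraction operator *)

Section Triangular.
Variables (K : fieldType) (h : vectType K) (br : h -> h -> h).
Implicit Types (p q s : dual h) (r : tens h h).

Lemma bilin_sum n (c d : 'I_n -> K) (x y : 'I_n -> h) : bilin br ->
  br (\sum_i c i *: x i) (\sum_j d j *: y j) =
  \sum_i \sum_j c i *: (d j *: br (x i) (y j)).
Proof.
case=> brr brl; rewrite (linear_comb _ _ _ (brl _)); apply: eq_bigr => i _.
by rewrite (linear_comb _ _ _ (brr _)) scaler_sumr.
Qed.

(** Each term of the equation brackets two legs of [r] and evaluates functionals on the other two.
    Antisymmetry lets either leg be contracted, at the price of a sign for each second leg that is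
    evaluated. *)
Lemma contr_yb r p q s : bilin br -> antisymmetric_tensor r ->
  s (contr q (contr p (yb br r))) =
  p (br (contr q r) (contr s r)) - q (br (contr p r) (contr s r))
  + s (br (contr p r) (contr q r)).
Proof.
move=> brb /antisymmetric_contr ra; have [brr brl] := brb.
have brN x y : br (- x) y = - br x y.
  by rewrite -(linfunE (brl y)) linearN /= linfunE.
have brNr x y : br x (- y) = - br x y.
  by rewrite -(linfunE (brr x)) linearN /= linfunE.
have [a [b rE]] := tens_pure_sum r.
(* [FE] contracts the first leg and [GE] the second. The term in [p] uses [GE] twice, so its signs
   cancel; the term in [q] uses it once; the term in [s] not at all. *)
have FE t : contr t r = \sum_i (t (a i) : K) *: b i.
  by rewrite rE linear_sum; apply: eq_bigr => i _; rewrite /= contr_pure.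
have GE t : contr t r = - \sum_i (t (b i) : K) *: a i.
  apply: dual_ext => u; rewrite ra FE linearN; apply: (congr1 -%R); rewrite !linear_sum.
  by apply: eq_bigr => i _; rewrite !linearZ; apply: mulrC.
rewrite rE yb_sum // -rE.
have -> : p (br (contr q r) (contr s r)) =
    p (br (\sum_i (q (b i) : K) *: a i) (\sum_j (s (b j) : K) *: a j)).
  by rewrite (GE q) (GE s) brN brNr opprK.
have -> : q (br (contr p r) (contr s r)) =
    - q (br (\sum_i (p (a i) : K) *: b i) (\sum_j (s (b j) : K) *: a j)).
  by rewrite (FE p) (GE s) brNr linearN.
rewrite opprK (FE p) (FE q) !bilin_sum // (contr_sum p) (contr_sum q).
rewrite !(linear_sum p) !(linear_sum q) !(linear_sum s) -!big_split.
apply: eq_bigr => i _; rewrite (contr_sum p) (contr_sum q).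
rewrite !(linear_sum p) !(linear_sum q) !(linear_sum s) -!big_split.
apply: eq_bigr => j _ /=.
rewrite !(contrD p) !contr_pure !(contrD q) !contrZ !contr_pure.
rewrite !linearD /= !linearZ /= -![_ *: _]/(_ * _ : K).
rewrite -[LHS]/(_ : K) -[RHS]/(_ : K); ring.
Qed.

Lemma yb_eq0 r : bilin br -> antisymmetric_tensor r ->
  yb br r = 0 <->
  forall p q s, p (br (contr q r) (contr s r)) - q (br (contr p r) (contr s r))
    + s (br (contr p r) (contr q r)) = 0.
Proof.
move=> brb ra; split=> [yb0 p q s|yb0].
  by rewrite -contr_yb // yb0 !linear0.
by apply: contr_sep => p; apply: contr_sep => q; apply: dual_sep => s;
   rewrite contr_yb.
Qed.

Lemma tmap_id_eq r (f1 f2 : h -> h) : linear f1 -> linear f2 ->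
  tmap f1 idfun r - tmap idfun f2 r = 0 <->
  forall p, contr (transpose (linfun f1) p) r = f2 (contr p r).
Proof.
move=> f1l f2l; have il : linear (idfun : h -> h) by [].
split=> [/subr0_eq e p|e].
  by have := congr1 (contr p) e; rewrite contr_tmap // contr_tmap_id.
apply/eqP; rewrite subr_eq0; apply/eqP/contr_ext => p.
by rewrite contr_tmap // contr_tmap_id // e.
Qed.

Lemma contr_ad2 x p r : linear (br x) ->
  contr p (ad2 br x r) = contr (transpose (linfun (br x)) p) r + br x (contr p r).
Proof.
move=> brl; have il : linear (idfun : h -> h) by [].
by rewrite /ad2 contrD contr_tmap // contr_tmap_id.
Qed.

(** * Coboundary Lie bialgebras and their Rota-Baxter versions *)

Hypothesis br_lie : is_lie br.

Let brr x : linear (br x).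
Proof. by case: br_lie => [[+ _] _ _]. Qed.
Let brl y : linear (br^~ y).
Proof. by case: br_lie => [[_ +] _ _]. Qed.

Lemma lie_anti x y : br x y = - br y x.
Proof.
have [_ alt _] := br_lie; have := alt (1 *: x + y).
rewrite (brl _ 1) !(brr _ 1) !scale1r !alt add0r addr0 => /eqP.
by rewrite addr_eq0 => /eqP.
Qed.

Lemma lie_jacobi x y z : br (br x y) z = br x (br y z) - br y (br x z).
Proof.
have [_ _ jac] := br_lie; have := jac x y z.
have brN u v : br u (- v) = - br u v by rewrite -(linfunE (brr u)) linearN /= linfunE.
rewrite (lie_anti z (br x y)) (lie_anti z x) brN => /eqP.
by rewrite subr_eq0 => /eqP <-.
Qed.

Lemma ad2_eval r x p q : antisymmetric_tensor r ->
  q (contr p (ad2 br x r)) = q (br x (contr p r)) - p (br x (contr q r)).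
Proof.
move=> /antisymmetric_contr ra; rewrite contr_ad2 // linearD /= ra transposeE.
by rewrite linfunE // addrC.
Qed.

Lemma ad2_coalgebra r : antisymmetric_tensor r -> yb br r = 0 ->
  is_lie_coalgebra (fun x => ad2 br x r).
Proof.
move=> ra yb0.
have dl : linear (fun x => ad2 br x r).
  move=> c x y; apply: contr_ext => p; apply: dual_ext => q.
  rewrite linearP linearP /= !ad2_eval // -!(linfunE (brl _)) !linearP /=.
  rewrite -![_ *: _]/(_ * _ : K) -[LHS]/(_ : K); ring.
split=> // [x|x].
  apply/antisymmetric_contr => p q; rewrite !ad2_eval //.
  rewrite -[LHS]/(_ : K); ring.
move=> t; apply: contr_sep => p; apply: contr_sep => q; apply: dual_sep => s.
have bb : bilin br by case: br_lie.
have yb1 := (yb_eq0 bb ra).1 yb0.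
(* Direct evaluation leaves two brackets containing the contraction of [r] with the functional [p']
   composed with [br x]. The Yang-Baxter equation, applied to that functional with [q'] and [s'],
   trades both for the last term. *)
have tE p' q' s' : s' (contr q' (contr p' t)) =
    s' (br (br x (contr p' r)) (contr q' r))
    - q' (br (br x (contr p' r)) (contr s' r))
    - p' (br x (br (contr q' r) (contr s' r))) :> K.
  rewrite /t contr_tmap_id // ad2_eval // contr_ad2 // -!(linfunE (brl (contr _ r))) !linearD /=.
  have /eqP := yb1 (transpose (linfun (br x)) p') q' s'.
  rewrite transposeE !linfunE // -addrA addr_eq0 => /eqP ->.
  rewrite -[LHS]/(_ : K) -[RHS]/(_ : K); ring.
(* With all brackets nested to the left, the cyclic sum has twelve terms, which cancel in pairs. *)
have J y z : br x (br y z) = br (br x y) z - br (br x z) y.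
  by rewrite lie_jacobi (lie_anti (br x z)) opprK subrK.
rewrite !contrD !linearD /= !contr_cyc3 !tE !J !linearB /=.
rewrite -[LHS]/(_ : K); ring.
Qed.

(** The compatibility is the cocycle condition, which holds because the cobracket is a
    coboundary. *)
Lemma ad2_bialgebra r : antisymmetric_tensor r -> yb br r = 0 ->
  is_lie_bialgebra br (fun x => ad2 br x r).
Proof.
move=> ra yb0; split=> [//||x y]; first exact: ad2_coalgebra.
apply: contr_ext => p; apply: dual_ext => q.
have [_ da _] := ad2_coalgebra ra yb0.
have bD u v w : br u (v + w) = br u v + br u w.
  by rewrite -!(linfunE (brr u)) linearD.
pose F u t := contr (transpose (linfun (br u)) t) r.
(* The last parenthesis, where [u] and [w] act on different legs, is symmetric in them and drops out
   of the commutator; the rest is handled by the Jacobi identity. *)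
have E u w : q (contr p (ad2 br u (ad2 br w r))) =
    q (br u (br w (contr p r))) - p (br u (br w (contr q r)))
    + (q (br u (F w p)) + q (br w (F u p))) :> K.
  rewrite ad2_eval // !contr_ad2 // !bD !linearD /= -/(F w p) -/(F w q).
  have -> : p (br u (F w q)) = - q (br w (F u p)).
    have /antisymmetric_contr raE := ra.
    by rewrite -!(linfunE (brr _)) -!transposeE [LHS]raE.
  rewrite -[LHS]/(_ : K); ring.
rewrite linearB /= linearB /= !E ad2_eval // !lie_jacobi !linearB /=.
rewrite -[LHS]/(_ : K) -[RHS]/(_ : K); ring.
Qed.

Variables (lambda : K) (R S : h -> h).

(** By the intertwining conditions, [R] or [S] composed with a functional becomes [S] or [R] applied
    to its contraction. The first compatibility is then [S]-admissibility with the bracket reversed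
    ([SE]). In the second, the terms in [q] form [S]-admissibility and those in [p] the Rota-Baxter
    identity. *)
Lemma ad2_rb_bialgebra r :
    is_admissible_rb_lie lambda br R S ->
    antisymmetric_tensor r -> admissible_cybe br R S r ->
  is_rb_lie_bialgebra lambda br R (fun x => ad2 br x r) S.
Proof.
move=> adm ra [yb0]; have [[_ Rl rb] Sl adS] := adm.
move=> /(tmap_id_eq _ Rl Sl) RS /(tmap_id_eq _ Sl Rl) SR.
have il : linear (idfun : h -> h) by [].
have Ip p : transpose (linfun idfun) p = p.
  by apply/lfunP => x; rewrite transposeE linfunE.
have SE x y : S (br x (R y)) = br (S x) (R y) + S (br (S x) y) + lambda *: br (S x) y.
  have SN u : S (- u) = - S u by rewrite -!(linfunE Sl) linearN.
  have := adS y x; rewrite (lie_anti (R y) x) (lie_anti _ (S x)) !(lie_anti y) !SN.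
  by rewrite scalerN !opprK -!addrA addrC => /subr0_eq <-; rewrite addrA.
have tmapE p q (f1 f2 : h -> h) t : linear f1 -> linear f2 ->
    q (contr p (tmap f1 f2 t)) =
    transpose (linfun f2) q (contr (transpose (linfun f1) p) t).
  by move=> f1l f2l; rewrite contr_tmap // transposeE linfunE.
have pD (t : dual h) u v : t (u + v) = (t u + t v : K) by exact: linearD.
have pZ (t : dual h) c v : t (c *: v) = (c * t v : K) by exact: linearZ.
pose E := (RS, SR, transposeE, linfunE Rl, linfunE Sl).
(* [d] keeps [contrD] from unfolding [ad2]. *)
have [d dE] : exists d, forall x, ad2 br x r = d x by exists ((ad2 br)^~ r).
split=> // [|x|x]; rewrite ?dE; first exact: ad2_bialgebra.
- apply: contr_ext => p; apply: dual_ext => q.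
  rewrite !(contrD, contrZ) !linearD linearZ /= !tmapE // !Ip.
  rewrite -!dE !ad2_eval // !E !SE -!(linfunE Sl) !(linearD, linearZ) /=.
  rewrite -![_ *: _]/(_ * _ : K) -[LHS]/(_ : K) -[RHS]/(_ : K); ring.
- apply: contr_sep => p; apply: dual_sep => q.
  rewrite !(contrD, contrN, contrZ) !linearD linearN linearZ /= !tmapE // !Ip.
  have adS' u v : S (br (R u) v) = br (R u) (S v) + S (br u (S v)) + lambda *: br u (S v).
    by have /eqP := adS u v; rewrite -!addrA -!opprD subr_eq0 !addrA => /eqP.
  rewrite -!dE !ad2_eval // !E !rb !adS'.
  rewrite !pD !pZ -![_ *: _]/(_ * _ : K) -[LHS]/(_ : K); ring.
Qed.

End Triangular.

(** * Admissibility on the semidirect product *)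

Section Semidirect.
Variables (K : fieldType) (lambda : K) (g V : vectType K).
Variables (br : g -> g -> g) (rho : g -> 'End(V)).
Implicit Types p q s : dual (g * dual V)%type.

Lemma dsum_transpose_linear (f : 'End(g)) (f' : 'End(V)) :
  linear (dsum f (transpose f')).
Proof.
move=> c [x p] [y q]; congr (_, _); first exact: linearP.
by apply/lfunP => v; rewrite /= !(transposeE, add_lfunE, scale_lfunE).
Qed.

(** In the dual component, evaluated at a vector, the terms in [q] are the condition on [alpha] in a
    Rota-Baxter representation, and the terms in [p] are the identity relating [alpha], [beta] and
    [Q]. *)
Lemma semidirect_admissible (P Q : 'End(g)) (alpha beta : 'End(V)) :
    is_rb_lie lambda br P -> admissible_on lambda P rho beta ->
    is_rb_rep lambda br P rho alpha -> is_admissible_rb_lie lambda br P Q ->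
    (forall x v, beta (rho x (alpha v)) =
       beta (rho (Q x) v) + rho (Q x) (alpha v) + lambda *: rho (Q x) v) ->
  is_admissible_rb_lie lambda (semidirect br rho) (dsum P (transpose beta))
    (dsum Q (transpose alpha)).
Proof.
move=> rbP admP [rep _ rba] [_ _ adQ] hQ.
split; [exact: semidirect_rb_lie | exact: dsum_transpose_linear |].
move=> [x p] [y q]; congr (_, _); first exact: adQ.
have pD (t : dual V) u v : t (u + v) = (t u + t v : K) by exact: linearD.
have pZ (t : dual V) c v : t (c *: v) = (c * t v : K) by exact: linearZ.
apply/lfunP => v.
rewrite /= !(add_lfunE, opp_lfunE, scale_lfunE, dual_repE, transposeE, zero_lfunE).
rewrite rba hQ !pD !pZ -![_ *: _]/(_ * _ : K) -[LHS]/(_ : K); ring.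
Qed.

(** * The antisymmetric tensor attached to a linear map *)

Variable T : 'Hom(V, g).
Let r := tensor_of T - flip (tensor_of T).

Lemma antisymmetric_sub_flip (U : vectType K) (t : tens U U) :
  antisymmetric_tensor (t - flip t).
Proof.
by apply/antisymmetric_contr => p q; rewrite !contrD !contrN !linearB /= !contr_flip;
   rewrite -[LHS]/(_ : K) -[RHS]/(_ : K); ring.
Qed.

(** The [dual g] half of the identification of a functional on [g * dual V] with a pair; the half in
    [V] is the vector given by [dual_pair_eval]. *)
Definition inl_dual p : dual g :=
  linfun (fun x => p (x, 0 : dual V) : K^o).

Lemma inl_dualE p x : inl_dual p x = p (x, 0).
Proof.
have jl : linear (fun x => p (x, 0 : dual V) : K^o).
  by move=> c y z; rewrite -linearP; congr (p (_, _)); rewrite /= scaler0 addr0.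
exact: linfunE.
Qed.

Lemma contr_tensor_of p : contr p (tensor_of T) = (0, transpose T (inl_dual p)).
Proof.
rewrite /tensor_of contr_sum; under eq_bigr do rewrite contr_pure.
have jl : linear (fun xi : dual V => (0 : g, xi)).
  by move=> c x y; congr (_, _); rewrite /= scaler0 addr0.
rewrite -(linear_comb _ _ _ jl); congr (_, _); apply/lfunP => v.
rewrite sum_lfunE transposeE inl_dualE {2}(coord_vbasis (memvf v)) linear_sum /=.
rewrite -inl_dualE linear_sum; apply: eq_bigr => i _.
by rewrite scale_lfunE lfunE linearZ /= linearZ /= inl_dualE; apply: mulrC.
Qed.

(** The flipped tensor contributes [T v]: tested on [q], its contraction becomes [p] of the
    restriction of [q] composed with [T], and [p] acts there as evaluation at [v]. *)
Lemma contr_tensor p v : (forall xi, p (0, xi) = xi v) ->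
  contr p r = (- T v, transpose T (inl_dual p)).
Proof.
move=> pv; have -> : (- T v, transpose T (inl_dual p))
    = (0, transpose T (inl_dual p)) - (T v, 0).
  by congr (_, _); rewrite /= ?sub0r ?subr0.
rewrite contrD contrN contr_tensor_of; congr (_ - _).
apply: dual_ext => q.
by rewrite contr_flip contr_tensor_of pv transposeE inl_dualE.
Qed.

Lemma dual_pair_eval p :
  exists v, forall xi, p (0, xi) = xi v.
Proof.
have jl : linear (fun xi => p (0 : g, xi) : K^o).
  by move=> c x y; rewrite -linearP; congr (p (_, _)); rewrite /= scaler0 addr0.
have [v vE] := dual_dual_eval (linfun (fun xi => p (0 : g, xi) : K^o)).
by exists v => xi; rewrite -vE linfunE.
Qed.

Lemma dual_pair_exists (f : dual g) (v : V) :
  exists p, forall x xi, p (x, xi) = f x + xi v.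
Proof.
have l : linear (fun z : (g * dual V)%type => f z.1 + z.2 v : K^o).
  move=> c [x p] [y q]; rewrite /= linearP add_lfunE scale_lfunE scalerDr.
  exact: addrACA.
by exists (linfun (fun z : (g * dual V)%type => f z.1 + z.2 v : K^o)) => x xi;
   rewrite linfunE.
Qed.

Lemma dual_pairE p v x xi :
  (forall eta, p (0, eta) = eta v) -> p (x, xi) = inl_dual p x + xi v.
Proof.
move=> pv; rewrite inl_dualE -pv -linearD; congr (p (_, _)).
  by rewrite /= addr0.
by rewrite /= add0r.
Qed.

(** The component in [g] gives the first identity and the component in [dual V] the second. The four
    maps are arbitrary so that both intertwining conditions, which exchange the two operators, are
    instances. *)
Lemma tensor_intertwine (f1 f2 : 'End(g)) (f1' f2' : 'End(V)) :
  (forall p, contr (transpose (linfun (dsum f1 (transpose f1'))) p) r =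
             dsum f2 (transpose f2') (contr p r)) <->
  (forall v, T (f1' v) = f2 (T v)) /\ (forall v, f1 (T v) = T (f2' v)).
Proof.
(* Composing with the transposed sum turns the pair of [p] into its first half composed with [f1]
   and the vector [f1' v]. *)
have cE p v : (forall xi, p (0, xi) = xi v) ->
    contr (transpose (linfun (dsum f1 (transpose f1'))) p) r =
    (- T (f1' v), transpose (f1 \o T)%VF (inl_dual p)).
  move=> pv; rewrite (@contr_tensor _ (f1' v)).
    congr (_, _); apply/lfunP => u.
    rewrite !transposeE !inl_dualE transposeE linfunE; last exact: dsum_transpose_linear.
    rewrite comp_lfunE; congr (p (_, _)); apply/lfunP => w.
    by rewrite /= transposeE !zero_lfunE.
  move=> xi; rewrite transposeE linfunE; last exact: dsum_transpose_linear.
  by rewrite /dsum /= linear0 pv transposeE.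
split=> [e|[e1 e2] p].
  split=> v.
    have [p pE] := dual_pair_exists 0 v.
    have pv xi : p (0, xi) = xi v by rewrite pE zero_lfunE add0r.
    have := e p; rewrite (cE _ _ pv) (contr_tensor pv) => /(congr1 fst) /=.
    by rewrite linearN /= => /oppr_inj.
  apply: dual_ext => f; have [p pE] := dual_pair_exists f 0.
  have pv xi : p (0, xi) = xi 0 by rewrite pE !linear0 add0r.
  have := e p; rewrite (cE _ _ pv) (contr_tensor pv).
  move=> /(congr1 (fun z : (g * dual V)%type => z.2 v)) /=.
  by rewrite !transposeE comp_lfunE !inl_dualE !pE zero_lfunE !addr0.
have [v pv] := dual_pair_eval p.
rewrite (cE _ _ pv) (contr_tensor pv); congr (_, _); rewrite /= ?e1 ?linearN //.
by apply/lfunP => u; rewrite !transposeE comp_lfunE /= e2.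
Qed.

Hypotheses (lie : is_lie br) (rep : is_lie_rep br rho).
Hypothesis semi_lie : is_lie (semidirect br rho).

Lemma yb_tensor :
  yb (semidirect br rho) r = 0 <->
  (forall u v, br (T u) (T v) = T (rho (T u) v - rho (T v) u)).
Proof.
have [brb _ _] := semi_lie; have [[brr brl] _ _] := lie; have [rhol _] := rep.
have ra := antisymmetric_sub_flip (tensor_of T).
have rhoN x : rho (- x) = - rho x.
  by rewrite -(linfunE rhol) linearN /= linfunE.
have brNN x y : br (- x) (- y) = br x y.
  by rewrite -(linfunE (brl _)) linearN /= linfunE // -(linfunE (brr _)) linearN /= opprK linfunE.
have pN (t : dual g) x : t (- x) = (- t x : K) by exact: linearN.
have pB (t : dual g) x y : t (x - y) = (t x - t y : K) by exact: linearB.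
have TB x y : T (x - y) = T x - T y by exact: linearB.
have TN x : T (- x) = - T x by exact: linearN.
(* The defect of the operator identity; the Yang-Baxter form will be linear in its three values. *)
pose D u v := br (T u) (T v) - T (rho (T u) v - rho (T v) u).
have ybE p q s u v w :
    (forall xi, p (0, xi) = xi u) -> (forall xi, q (0, xi) = xi v) ->
    (forall xi, s (0, xi) = xi w) ->
    p (semidirect br rho (contr q r) (contr s r))
    - q (semidirect br rho (contr p r) (contr s r))
    + s (semidirect br rho (contr p r) (contr q r)) =
    inl_dual p (D v w) - inl_dual q (D u w) + inl_dual s (D u v) :> K.
  move=> pu qv sw.
  rewrite (contr_tensor pu) (contr_tensor qv) (contr_tensor sw).
  rewrite /semidirect /= (dual_pairE _ _ pu) (dual_pairE _ _ qv) (dual_pairE _ _ sw).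
  rewrite !(add_lfunE, opp_lfunE, dual_repE, transposeE) !rhoN.
  rewrite !brNN !opp_lfunE /D !(TB, TN) !(pN, pB).
  rewrite -[LHS]/(_ : K) -[RHS]/(_ : K); ring.
split=> [|e].
  move/(yb_eq0 brb ra).1 => e u v; apply/subr0_eq/dual_sep => f.
  (* With [q] and [s] vanishing on [g], only the term [f (D u v)] survives. *)
  have [p pE] := dual_pair_exists f 0.
  have [q qE] := dual_pair_exists 0 u.
  have [s sE] := dual_pair_exists 0 v.
  have := ybE p q s 0 u v; rewrite e !inl_dualE !pE !qE !sE.
  by rewrite !zero_lfunE !addr0 subr0 -/(D _ _) => <- // xi; rewrite ?(pE, qE, sE) linear0 add0r.
apply/(yb_eq0 brb ra) => p q s.
have [u pu] := dual_pair_eval p; have [v qv] := dual_pair_eval q.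
have [w sw] := dual_pair_eval s.
by rewrite (ybE _ _ _ _ _ _ pu qv sw) /D !e !subrr !linear0 !addr0.
Qed.

End Semidirect.

(** * Characterization of the solutions and the resulting bialgebra *)

Theorem theorem4p18 (K : fieldType) (lambda : K) (g V : vectType K)
    (br : g -> g -> g) (P Q : 'End(g)) (rho : g -> 'End(V))
    (alpha beta : 'End(V)) (T : 'Hom(V, g)) :
  [pchar K] =i pred0 ->
  is_rb_lie lambda br P ->
  is_lie_rep br rho ->
  admissible_on lambda P rho beta ->
  let br' := semidirect br rho in
  let R := dsum P (transpose beta) in
  let S := dsum Q (transpose alpha) in
  let r := tensor_of T - flip (tensor_of T) in
  ((antisymmetric_tensor r /\ admissible_cybe br' R S r)
   <-> (weak_O_operator br P rho alpha T /\
        (forall v, T (beta v) = Q (T v))))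
  /\
  (is_rb_rep lambda br P rho alpha ->
   O_operator lambda br P rho alpha T ->
   (forall v, T (beta v) = Q (T v)) ->
   (antisymmetric_tensor r /\ admissible_cybe br' R S r)
   /\
   (is_admissible_rb_lie lambda br P Q ->
    (forall x v, beta (rho x (alpha v)) =
       beta (rho (Q x) v) + rho (Q x) (alpha v) + lambda *: rho (Q x) v) ->
    is_rb_lie_bialgebra lambda br' R (fun u => ad2 br' u r) S)).
Proof.
move=> _ rbP rep admP br' R S r.
have [lie _ _] := rbP.
have [lie' _ _] := semidirect_rb_lie rbP rep admP.
have Rl : linear R by exact: dsum_transpose_linear.
have Sl : linear S by exact: dsum_transpose_linear.
have ra : antisymmetric_tensor r by exact: antisymmetric_sub_flip.
(* Each intertwining condition amounts to [T beta = Q T] together with [P T = T alpha]; in [SR] the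
   two appear in the other order with their sides exchanged. *)
have RS := iff_trans (tmap_id_eq r Rl Sl) (tensor_intertwine T P Q beta alpha).
have SR := iff_trans (tmap_id_eq r Sl Rl) (tensor_intertwine T Q P alpha beta).
have YB := yb_tensor T lie rep lie'.
have main : (antisymmetric_tensor r /\ admissible_cybe br' R S r)
   <-> (weak_O_operator br P rho alpha T /\
        (forall v, T (beta v) = Q (T v))).
  split=> [[_ [/YB O /RS[TQ PT] _]]|[[O PT] TQ]]; first by split.
  split=> //; split; [exact/YB | exact/RS | apply/SR; split=> v].
    by rewrite PT.
  by rewrite TQ.
split=> // rba [_ O] TQ; have sol := main.2 (conj O TQ).
split=> // adQ hQ; apply: ad2_rb_bialgebra => //; last by case: sol.
exact: semidirect_admissible.
Qed.
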